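(* Every infinite minimal noncommutative ring is a division ring.
   Context: All rings are associative with $1$, and subrings contain the identity element. A ring $R$ is minimal noncommutative if it is not commutative but all its proper subrings and all its proper homomorphic images (quotients by nonzero two-sided ideals) are commutative. *)

(* Defs.v *)
From mathcomp Require Import all_boot all_algebra.
From mathcomp Require Import boolp classical_sets functions cardinality.

Set Implicit Arguments.
Unset Strict Implicit.
Unset Printing Implicit Defensive.

Import GRing.Theory.
Local Open Scope classical_set_scope.
Local Open Scope ring_scope.

(* [pzRingType] is the class of all associative unital rings, including the
   zero ring; the latter is needed since it is the homomorphic image of R
   given by the ideal R itself. *)

Definition commutative_ring (R : pzRingType) : Prop :=
  forall x y : R, x * y = y * x.

(* MathComp's [subring_closed] includes [1 \in S]. *)
Definition proper_subrings_commutative (R : pzRingType) : Prop :=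
  forall S : set R, subring_closed (fun x => x \in S) -> S <> [set: R] ->
  forall x y : R, S x -> S y -> x * y = y * x.

(* Up to isomorphism, the quotients of R by its nonzero two-sided ideals are
   the codomains of the surjective ring morphisms with nonzero kernel. *)
Definition proper_images_commutative (R : pzRingType) : Prop :=
  forall (Q : pzRingType) (f : {rmorphism R -> Q}),
  set_surj [set: R] [set: Q] f -> (exists2 x : R, x != 0 & f x = 0) ->
  commutative_ring Q.

Definition minimal_noncommutative (R : pzRingType) : Prop :=
  [/\ ~ commutative_ring R,
      proper_subrings_commutative R
    & proper_images_commutative R].

Definition division_ring (R : pzRingType) : Prop :=
  (1 : R) != 0 /\
  forall x : R, x != 0 -> exists y : R, x * y = 1 /\ y * x = 1.

(* Main.v *)
Require Import Defs.
From HB Require Import structures.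
From mathcomp Require Import all_boot all_order all_algebra.
From mathcomp Require Import boolp classical_sets functions cardinality.

Set Implicit Arguments.
Unset Strict Implicit.
Unset Printing Implicit Defensive.

Import Order.TTheory GRing.Theory Num.Theory.
Local Open Scope classical_set_scope.
Local Open Scope ring_scope.

(* Any two noncommuting elements generate R, and the heart H (the intersection
   of the nonzero ideals) contains all commutators, so it is the least nonzero
   ideal.

   If H^2 <> 0, then R is prime. A right ideal J that contains two noncommuting
   elements satisfies Z + J = R; applied to J = aR this shows that R is reduced,
   hence a domain, and that R = Z + aR for all a <> 0. Writing a = n + a^2 t
   shows that a is right invertible or divides a nonzero integer, and nonzero
   integers are invertible.

   If H^2 = 0, then left and right multiplications commute on H, which makes H a
   field generated as a ring by four elements; by Zariski's lemma H is finite.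
   So for every x some monic integer polynomial in x has a value m that
   annihilates H on both sides. Then m^2 is central, and it is nilpotent: since
   R/H is noetherian, the annihilators of the powers of a central z with zH = 0
   stabilize, while H lies in each nonzero z^k R. Likewise some nonzero integer
   vanishes in R. Hence R/H, and with it R, is finite. *)

(** * Quotient rings by two-sided ideals *)

Definition two_sided_ideal (R : pzRingType) (I : set R) : Prop :=
  [/\ I 0, forall x y, I x -> I y -> I (x - y),
      forall r x, I x -> I (r * x) & forall r x, I x -> I (x * r)].

Local Open Scope quotient_scope.

(** Needed because [proper_images_commutative] speaks of surjective morphisms, whereas the heart is
    defined by ideals. *)
Lemma quotient_exists (R : pzRingType) (I : set R) : two_sided_ideal I ->
  exists (Q : pzRingType) (f : {rmorphism R -> Q}),
    (forall q, exists x, f x = q) /\ (forall x, f x = 0 <-> I x).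
Proof.
move=> [I0 IB Il Ir].
pose S : {pred R} := fun x => `[< I x >].
have S0 : zmod_closed S.
  split; first exact/asboolP.
  by move=> x y /asboolP Ix /asboolP Iy; apply/asboolP/IB.
pose ZS := GRing.isZmodClosed.Build R S S0.
pose SZ : zmodClosed R := HB.pack S ZS.
pose T : zmodType := Quotient.quot SZ.
have eqT x y : (\pi_T x = \pi_T y) <-> I (x - y).
  split=> [/eqP|h].
    by rewrite piE Quotient.equivE => /asboolP.
  by apply/eqP; rewrite piE Quotient.equivE; apply/asboolP.
pose pi (x : R) : T := \pi_T x.
have piK q : pi (repr q) = q by exact: reprK.
have piB x y : pi (x - y) = pi x - pi y.
  by rewrite /pi (@Quotient.pi_add R SZ) (@Quotient.pi_opp R SZ).
have pi0 : pi 0 = 0 by rewrite -(subrr (0 : R)) piB subrr.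
have piN x : pi (- x) = - pi x by rewrite -(sub0r x) piB pi0 sub0r.
have piD x y : pi (x + y) = pi x + pi y by rewrite -{1}[y]opprK piB piN opprK.
have {}eqT x y : (pi x = pi y) <-> I (x - y) by exact: eqT.
(* Forgets the body of [pi]; only the listed equations are used from here on. *)
move: pi piK piB pi0 piN piD eqT => pi piK piB pi0 piN piD eqT.
pose mul (x y : T) : T := pi (repr x * repr y).
have mulE x y : mul (pi x) (pi y) = pi (x * y).
  rewrite /mul; apply/eqT.
  have /eqT := piK (pi x); have /eqT := piK (pi y).
  set x' := repr _; set y' := repr _ => h2 h1.
  have -> : y' * x' - x * y = (y' - x) * x' - - x * (x' - y).
    by rewrite mulNr opprK mulrBl mulrBr addrA subrK.
  by apply: (IB); [exact: Ir | exact: Il].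
have piP (P : T -> Prop) : (forall x, P (pi x)) -> forall q, P q.
  by move=> h q; rewrite -(piK q).
have mulA : associative mul.
  by do 3![elim/piP=> ?]; rewrite !mulE mulrA.
have m1l : left_id (pi 1) mul by elim/piP=> x; rewrite mulE mul1r.
have m1r : right_id (pi 1) mul by elim/piP=> x; rewrite mulE mulr1.
have mDl : left_distributive mul +%R.
  by do 3![elim/piP=> ?]; rewrite -piD !mulE -piD mulrDl.
have mDr : right_distributive mul +%R.
  by do 3![elim/piP=> ?]; rewrite -piD !mulE -piD mulrDr.
pose RT := GRing.Zmodule_isPzRing.Build T mulA m1l m1r mDl mDr.
pose Q : pzRingType := HB.pack T RT.
have piM : monoid_morphism (pi : R -> Q) by split=> // x y; rewrite -mulE.
pose mx := GRing.isZmodMorphism.Build R Q pi piB.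
pose my := GRing.isMonoidMorphism.Build R Q pi piM.
pose f : {rmorphism R -> Q} := HB.pack pi mx my.
exists Q, f; split=> [|x]; first by elim/piP=> x; exists x.
by rewrite -{2}(subr0 x) -eqT pi0.
Qed.

Local Close Scope quotient_scope.

(** * The heart and the prime case *)

Section Minimal.
Variable R : pzRingType.
Hypothesis Rmin : minimal_noncommutative R.

(** A subring containing [x] and [y] is noncommutative, hence not proper. It serves below as an
    induction principle on the elements of [R]. *)
Lemma noncomm_pair_generates (S : set R) (x y : R) : x * y <> y * x ->
  S 1 -> (forall u v, S u -> S v -> S (u - v)) ->
  (forall u v, S u -> S v -> S (u * v)) -> S x -> S y -> forall z, S z.
Proof.
move=> xy S1 SB SM Sx Sy z.
have [_ /(_ S) Hsub _] := Rmin.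
suff -> : S = [set: R] by [].
apply: contrapT => nS; apply: xy; apply: Hsub => //.
split=> [|u v|u v]; rewrite ?inE //; [exact: SB | exact: SM].
Qed.

Lemma noncomm_pair : exists x y : R, x * y <> y * x.
Proof.
have [nC _ _] := Rmin; apply: contrapT => h; apply: nC => x y.
by apply: contrapT => xy; apply: h; exists x, y.
Qed.

Lemma one_neq0 : (1 : R) <> 0.
Proof.
move=> e; have [x [y]] := noncomm_pair.
by rewrite -[x]mul1r e !mul0r mulr0.
Qed.

Definition heart : set R := [set x | forall I : set R,
  two_sided_ideal I -> (exists2 y, I y & y <> 0) -> I x].

(** The quotient by any nonzero ideal is commutative, so that ideal contains every commutator. *)
Lemma heart_comm (x y : R) : heart (x * y - y * x).
Proof.
move=> I idI [u Iu u0].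
have [Q [f [fs fk]]] := quotient_exists idI.
apply/fk; rewrite rmorphB !rmorphM; apply/eqP; rewrite subr_eq0; apply/eqP.
have [_ _ /(_ Q f)] := Rmin; apply.
- by move=> q _; have [x' <-] := fs q; exists x'.
- by exists u; [exact/eqP | exact/fk].
Qed.

Lemma heart_ideal : two_sided_ideal heart.
Proof.
split=> [I [] //|x y hx hy I iI nI|r x hx I iI nI|r x hx I iI nI].
- by have [_ IB _ _] := iI; apply: IB; [exact: hx | exact: hy].
- by have [_ _ Il _] := iI; apply: Il; exact: hx.
- by have [_ _ _ Ir] := iI; apply: Ir; exact: hx.
Qed.

(** Used to spread a property: if it defines an ideal and holds at one nonzero element, it holds on
    the whole heart. *)
Lemma heart_sub (I : set R) (u : R) :
  two_sided_ideal I -> I u -> u <> 0 -> forall x, heart x -> I x.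
Proof. by move=> iI Iu u0 x; apply => //; exists u. Qed.

Lemma heart0 : heart 0. Proof. by have [] := heart_ideal. Qed.
Lemma heartB x y : heart x -> heart y -> heart (x - y).
Proof. by have [_ + _ _] := heart_ideal; apply. Qed.
Lemma heartN x : heart x -> heart (- x).
Proof. by rewrite -sub0r; apply: heartB; exact: heart0. Qed.
Lemma heartD x y : heart x -> heart y -> heart (x + y).
Proof. by move=> hx hy; rewrite -[y]opprK; apply: heartB => //; exact: heartN. Qed.
Lemma heartMl r x : heart x -> heart (r * x).
Proof. by have [_ _ + _] := heart_ideal; apply. Qed.
Lemma heartMr r x : heart x -> heart (x * r).
Proof. by have [_ _ _ +] := heart_ideal; apply. Qed.

(** [Z + J] is a subring, since integers are central and [u v - n m = (u - n) v + (v - m) n]; it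
    contains the noncommuting [x] and [y]. *)
Lemma int_add_right_ideal (J : set R) (x y : R) :
  (forall u v, J u -> J v -> J (u - v)) -> (forall u r, J u -> J (u * r)) ->
  J x -> J y -> x * y <> y * x -> forall z, exists n : int, J (z - n%:~R).
Proof.
move=> JB JM Jx Jy xy.
have J0 : J 0 by rewrite -(subrr x); apply: JB.
have JD u v : J u -> J v -> J (u + v).
  by move=> Ju Jv; rewrite -[v]opprK; apply: (JB) => //; rewrite -sub0r; apply: JB.
apply: (@noncomm_pair_generates [set z | exists n : int, J (z - n%:~R)] x y) => //=.
- by exists 1; rewrite subrr.
- move=> u v [n Jn] [m Jm]; exists (n - m); rewrite intrB opprD addrACA -opprD.
  exact: JB.
- move=> u v [n Jn] [m Jm]; exists (n * m).
  have -> : u * v - (n * m)%:~R = (u - n%:~R) * v + (v - m%:~R) * n%:~R.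
    rewrite !mulrBl (commr_int v n) [m%:~R * _]commr_int intrM.
    by rewrite addrA subrK.
  by apply: JD; apply: JM.
- by exists 0; rewrite subr0.
- by exists 0; rewrite subr0.
Qed.

Lemma int_add_principal (a r s : R) : a * r * (a * s) <> a * s * (a * r) ->
  forall z, exists (n : int) t, z = n%:~R + a * t.
Proof.
move=> ars z.
have [||||n [t e]] := @int_add_right_ideal [set z | exists t, z = a * t] (a * r) (a * s) _ _ _ _ ars z.
- by move=> _ _ [t ->] [t' ->]; exists (t - t'); rewrite mulrBr.
- by move=> _ t' [t ->]; exists (t * t'); rewrite mulrA.
- by exists r.
- by exists s.
by exists n, t; rewrite -e addrC subrK.
Qed.

Section PrimeCase.
Hypothesis heart_sq : ~ (forall x y, heart x -> heart y -> x * y = 0).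

(** Suppose [a R b = 0] with [a], [b] nonzero. The ideal of all [x] with [x R b = 0] contains [a],
    hence the heart [H]; then the ideal of all [y] with [H y = 0] contains [b], hence [H], and
    [H^2 = 0]. *)
Lemma prime_ring (a b : R) : (forall r, a * r * b = 0) -> a = 0 \/ b = 0.
Proof.
move=> ab; apply: contrapT => /not_orP[a0 b0]; apply: heart_sq.
have hb : forall x r, heart x -> x * r * b = 0.
  move=> x r hx; move: r.
  apply: (heart_sub (I := [set x | forall r, x * r * b = 0]) (u := a)) => //.
  split=> /= [r|u v hu hv r|s u hu r|s u hu r].
  - by rewrite !mul0r.
  - by rewrite !mulrBl hu hv subrr.
  - by rewrite -!mulrA (mulrA u) hu mulr0.
  - by rewrite -(mulrA u) hu.
suff hs : forall y, heart y -> forall x, heart x -> x * y = 0.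
  by move=> x y hx hy; apply: hs.
apply: (heart_sub (u := b)) => //; last by move=> x hx; rewrite -(mulr1 x) hb.
split=> /= [x|u v hu hv x hx|s u hu x hx|s u hu x hx].
- by rewrite mulr0.
- by rewrite mulrBr hu // hv // subrr.
- by rewrite mulrA hu //; exact: heartMr.
- by rewrite mulrA hu // mul0r.
Qed.

(** If [a <> 0], primeness gives [a r a <> 0], so [a] and [a r] do not commute and [R = Z + aR].
    Writing [r = n + a s] yields [a r a = n a^2 + a^2 s a = 0]. *)
Lemma sqr_eq0 (a : R) : a * a = 0 -> a = 0.
Proof.
move=> aa; apply: contrapT => a0.
have [r ar0] : exists r, a * r * a <> 0.
  apply: contrapT => h; case: a0.
  have [] // := @prime_ring a a.
  by move=> r; apply: contrapT => h'; apply: h; exists r.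
have [|n [s e]] := @int_add_principal a 1 r _ r.
  by rewrite mulr1 mulrA aa mul0r => /esym.
by apply: ar0; rewrite e mulrDr mulrDl (commr_int a n) -mulrA aa mulr0 add0r
  (mulrA a a) aa !mul0r.
Qed.

(** First [b a] squares to zero and so vanishes; then each [a r b] squares to zero and vanishes, and
    primeness applies. *)
Lemma prime_domain (a b : R) : a * b = 0 -> a = 0 \/ b = 0.
Proof.
move=> ab.
have ba : b * a = 0 by apply: sqr_eq0; rewrite mulrA -(mulrA b) ab mulr0 mul0r.
apply: prime_ring => r; apply: sqr_eq0.
by rewrite !mulrA -[_ * b * a]mulrA ba mulr0 !mul0r.
Qed.

Lemma mul_lreg (a x y : R) : a <> 0 -> a * x = a * y -> x = y.
Proof.
move=> a0 /eqP; rewrite -subr_eq0 -mulrBr => /eqP /prime_domain[] // /eqP.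
by rewrite subr_eq0 => /eqP.
Qed.

(** A noncommuting pair in [aR] is [a x], [a y] with [x], [y] noncommuting if [a] is central, and
    otherwise [a], [a r] with [r] not commuting with [a]. *)
Lemma int_add_nonzero (a : R) : a <> 0 ->
  forall z, exists (n : int) t, z = n%:~R + a * t.
Proof.
move=> a0.
have [ac|] := pselect (forall r, a * r = r * a).
  have [x [y xy]] := noncomm_pair.
  have aM u v : a * u * (a * v) = a * (a * (u * v)).
    by rewrite -mulrA (mulrA u) -ac -mulrA.
  apply: (@int_add_principal a x y); rewrite !aM => e; apply: xy.
  by do 2!apply: (mul_lreg a0).
move=> /existsNP[r ar]; apply: (@int_add_principal a 1 r) => e; apply: ar.
by apply: (mul_lreg a0); rewrite mulr1 -mulrA in e.
Qed.

Lemma int_mul_right (a : R) : a <> 0 -> exists (n : int) r, n%:~R <> 0 :> R /\ a * r = n%:~R.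
Proof.
move=> a0; have [|n [t e]] := @int_add_nonzero (a * a) _ a.
  by move=> /prime_domain[].
(* If [n = 0], cancelling [a] in [a = a^2 t] gives [a t = 1]; otherwise [a (1 - a t) = n]. *)
have [n0|n0] := pselect (n%:~R = 0 :> R).
  exists 1, t; split; first exact: one_neq0.
  by apply: (mul_lreg a0); rewrite mulr1 mulrA [RHS]e n0 add0r.
exists n, (1 - a * t); split=> //.
by rewrite mulrBr mulr1 mulrA {1}e addrK.
Qed.

(* A nonzero commutator is divisible by every nonzero integer [k], since
   [x] is congruent to an integer modulo [k], and it divides some nonzero
   integer [m]; so [m] is divisible by [n * m]. *)
Lemma int_right_inv (n : int) : n%:~R <> 0 :> R -> exists r : R, n%:~R * r = 1.
Proof.
move=> n0; have [x [y xy]] := noncomm_pair.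
have c0 : x * y - y * x <> 0 by move=> /eqP; rewrite subr_eq0 => /eqP.
have [m [s [m0 cs]]] := int_mul_right c0.
have mn0 : m%:~R * n%:~R <> 0 :> R by move=> /prime_domain[].
have [i [t xe]] := int_add_nonzero mn0 x.
have ce : x * y - y * x = m%:~R * (n%:~R * (t * y - y * t)).
  rewrite xe mulrDl mulrDr opprD addrACA (commr_int y i) subrr add0r.
  by rewrite [RHS]mulrA -!intrM (mulrA y) (commr_int y (m * n)) -!mulrA -mulrBr.
exists ((t * y - y * t) * s); apply: (mul_lreg m0).
by rewrite mulr1 -[RHS]cs ce -!mulrA.
Qed.

Lemma division_of_prime : division_ring R.
Proof.
split; first exact/eqP/one_neq0.
have rinv (a : R) : a <> 0 -> exists b, a * b = 1.
  move=> /int_mul_right[n [r [/int_right_inv[s ns] ar]]].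
  by exists (r * s); rewrite mulrA ar.
move=> a /eqP a0; have [b ab] := rinv a a0.
exists b; split=> //.
by apply: (mul_lreg a0); rewrite mulrA ab mul1r mulr1.
Qed.
End PrimeCase.
End Minimal.

(** * Zariski's lemma over the integers *)

Lemma minimizer (T : Type) (P : T -> Prop) (m : T -> nat) (x0 : T) : P x0 ->
  exists2 x, P x & forall y, P y -> (m x <= m y)%N.
Proof.
move=> Px0; have ex : exists n, `[< exists2 x, P x & m x = n >].
  by exists (m x0); apply/asboolP; exists x0.
case: (ex_minnP ex) => n /asboolP[x Px <-] h; exists x => // y Py.
by apply: h; apply/asboolP; exists y.
Qed.

Lemma finite_horner (B : comNzRingType) (D : set B) (x : B) (n : nat) :
  finite_set D ->
  finite_set [set y | exists P : {poly B},
    [/\ (size P <= n)%N, forall i, D P`_i & y = P.[x]]].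
Proof.
move=> finD; elim: n => [|n IH].
  apply: (@sub_finite_set _ _ [set 0]) => // y [P [+ _ ->]].
  by rewrite size_poly_leq0 => /eqP ->; rewrite horner0.
apply: sub_finite_set (finite_image2 (fun c y => c + y * x) finD IH).
move=> _ [P [sP DP ->]]; exists P`_0; first exact: DP.
exists (drop_poly 1 P).[x].
  exists (drop_poly 1 P); split=> // [|i]; last by rewrite coef_drop_poly.
  by rewrite size_drop_poly leq_subLR add1n.
rewrite -[in RHS](poly_take_drop 1 P) hornerD hornerM hornerXn expr1.
congr (_ + _); rewrite /take_poly poly_def big_ord1 expr0 alg_polyC.
by rewrite hornerC.
Qed.

Lemma rmorph_horner (A B : comNzRingType) (Phi : {rmorphism {poly A} -> B}) p :
  Phi p = (map_poly (Phi \o polyC) p).[Phi 'X].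
Proof.
elim/poly_ind: p => [|p c IH]; first by rewrite !rmorph0 horner0.
by rewrite !rmorphD !rmorphM /= map_polyX map_polyC hornerMXaddC IH.
Qed.

Section PseudoDivision.
Variables (A : comNzRingType) (F : fieldType) (phi : {rmorphism A -> F}).
Notation "p ^phi" := (map_poly phi p) (at level 2).
(** As [phi] may kill leading coefficients, degrees are measured over [F]; [top p] is the
    coefficient of [p] lying over the leading coefficient there. *)
Let top (p : {poly A}) := p`_(size p^phi).-1.

Lemma phi_top p : phi (top p) = lead_coef p^phi.
Proof. by rewrite lead_coefE coef_map. Qed.

(** Division over [F] with quotient and remainder lifted to [A]: scaling by powers of [top q]
    replaces division by the leading coefficient. *)
Lemma pseudo_division (q p : {poly A}) : q^phi != 0 ->
  exists j (t r : {poly A}),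
    (top q ^+ j *: p)^phi = (t * q + r)^phi /\ (size r^phi < size q^phi)%N.
Proof.
move=> q0; have [n] := ubnP (size p^phi); elim: n p => // n IH p sp.
have [lt_pq|le_qp] := ltnP (size p^phi) (size q^phi).
  by exists 0, 0, p; rewrite expr0 scale1r mul0r add0r.
pose d := (size p^phi - size q^phi)%N.
(* Over [F] both terms have the same degree and leading coefficient, so [p1] is shorter than [p]. *)
pose p1 := top q *: p - top p *: (q * 'X^d).
have sq : (0 < size q^phi)%N by rewrite size_poly_gt0.
have [|j [t [r [e sr]]]] := IH p1.
  rewrite -ltnS; apply: leq_trans sp; rewrite ltnS.
  have s0 : (0 < size p^phi)%N by exact: leq_trans le_qp.
  rewrite -(prednK s0) ltnS; apply/leq_sizeP => i.
  rewrite leq_eqVlt => /predU1P[<-|ip].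
    rewrite /p1 rmorphB /= !map_polyZ rmorphM /= map_polyXn coefB !coefZ coefMXn.
    have -> : ((size p^phi).-1 < d)%N = false.
      by rewrite /d ltnNge; apply/negbF; rewrite leq_subLR -(prednK sq) -(prednK s0) addSn ltnS leq_addl.
    have -> : ((size p^phi).-1 - d = (size q^phi).-1)%N.
      by rewrite /d -!subn1 subnAC subKn.
    by rewrite !phi_top -!lead_coefE mulrC subrr.
  have ip' : (size p^phi <= i)%N by rewrite -(prednK s0).
  rewrite /p1 rmorphB /= !map_polyZ rmorphM /= map_polyXn coefB !coefZ coefMXn.
  rewrite (nth_default _ ip') mulr0 sub0r.
  have di : (d <= i)%N by apply: leq_trans ip'; rewrite leq_subr.
  rewrite ltnNge di /= nth_default ?mulr0 ?oppr0 //.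
  by rewrite leq_subRL // addnC subnKC.
exists j.+1, (t + (top q ^+ j * top p) *: 'X^d), r; split=> //.
have -> : (t + (top q ^+ j * top p) *: 'X^d) * q + r =
    t * q + r + (top q ^+ j * top p) *: (q * 'X^d).
  by rewrite mulrDl addrAC -scalerAl ['X^d * q]mulrC.
rewrite [RHS]rmorphD /= -e -[RHS]rmorphD; congr (_ ^phi).
by rewrite /p1 scalerBr !scalerA exprSr subrK.
Qed.

End PseudoDivision.

(* The image of [phi] becomes a field after inverting a single element. In this
   form the hypothesis of Zariski's lemma passes from [{poly A}] down to [A]. *)
Definition field_after_inverting (A : comNzRingType) (F : fieldType)
    (phi : {rmorphism A -> F}) :=
  exists2 u, phi u != 0 &
    forall d, phi d != 0 -> exists e k, phi (e * d) = phi u ^+ k.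

(** For surjective [phi] one may invert [u = 1], so this includes that every field that is an image
    of [A] is finite. *)
Definition finite_in_fields (A : comNzRingType) :=
  forall (F : fieldType) (phi : {rmorphism A -> F}),
    field_after_inverting phi -> finite_set (range phi).

Lemma finite_range_int (B : nzRingType) (phi : {rmorphism int -> B}) (n : int) :
  n != 0 -> phi n = 0 -> finite_set (range phi).
Proof.
move=> n0 pn.
apply: (@sub_finite_set _ _ ((fun k : nat => phi k%:Z) @` `I_(absz n))).
  move=> _ [m _ <-]; exists (absz (m %% n)%Z).
    by rewrite /= -ltz_nat gez0_abs ?modz_ge0 // ltz_mod.
  rewrite /= gez0_abs ?modz_ge0 //.
  by rewrite [m in RHS](divz_eq m n) [RHS]rmorphD rmorphM /= pn mulr0 add0r.
exact/finite_image/finite_II.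
Qed.

(** Were [phi] injective, [u^2 + 1] would divide a power of [u] in the integers, although it is
    coprime to [u] and greater than 1. *)
Lemma int_finite_in_fields : finite_in_fields int.
Proof.
move=> F phi [u u0 hu].
have [[n [n0 pn]]|inj] := pselect (exists n : int, n != 0 /\ phi n = 0).
  exact: finite_range_int n0 pn.
exfalso.
have {}inj n : phi n = 0 -> n = 0.
  by move=> pn; apply: contrapT => /eqP n0; apply: inj; exists n.
have uz : u != 0 by apply: contraNneq u0 => ->; rewrite rmorph0.
pose d := u * u + 1 : int.
have d1 : 1 < d by rewrite ltrDr -expr2 exprn_even_gt0.
have d0 : phi d != 0.
  apply/eqP => /inj dd; by rewrite dd in d1.
have [e [k ek]] := hu d d0.
have {}ek : e * d = u ^+ k.
  by apply/eqP; rewrite -subr_eq0; apply/eqP/inj; rewrite rmorphB ek rmorphXn subrr.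
have cop : coprimez d u.
  by apply/coprimezP; exists (1, - u); rewrite /= /d mul1r mulNr addrAC subrr add0r.
have : coprimez d (u ^+ k) by exact: coprimezXr.
rewrite -ek /coprimez => /eqP g1.
have : (d %| gcdz d (e * d))%Z by rewrite dvdz_gcd dvdzz dvdz_mull.
by rewrite g1 dvdz1 => /eqP a1; have := d1; rewrite -(gtz0_abs (lt_trans ltr01 d1)) a1.
Qed.

Section Adjoin.
Variables (A : comNzRingType) (F : fieldType) (Phi : {rmorphism {poly A} -> F}).
Let phi : {rmorphism A -> F} := Phi \o polyC.
Notation "p ^phi" := (map_poly phi p) (at level 2).
Let top (p : {poly A}) := p`_(size p^phi).-1.
Hypothesis Phi_field : field_after_inverting Phi.

Let PhiE p : Phi p = (p^phi).[Phi 'X].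
Proof. exact: rmorph_horner. Qed.
Let PhiC c : Phi c%:P = phi c. Proof. by []. Qed.

(* Otherwise [1 + 'X * u] would divide a power of [u] as polynomials. *)
Lemma algebraic_generator : exists2 q, q^phi != 0 & Phi q = 0.
Proof.
apply: contrapT => nalg.
have inj p : Phi p = 0 -> p^phi = 0.
  by move=> p0; apply: contrapT => /eqP p0'; apply: nalg; exists p.
have [u u0 hu] := Phi_field.
pose d := 'X * u + 1.
have un0 : u^phi != 0 by apply: contraNneq u0 => e; rewrite PhiE e horner0.
have dE : d^phi = 'X * u^phi + 1.
  by rewrite /d !rmorphD !rmorphM /= map_polyX rmorph1.
have sd : (1 < size d^phi)%N.
  have sX : (1 < size ('X * u^phi)%R)%N.
    by rewrite mulrC size_mulX // ltnS size_poly_gt0.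
  by rewrite dE size_polyDl // size_poly1.
have [|e [k ek]] := hu d.
  by apply/eqP => /inj d0; rewrite d0 size_poly0 in sd.
have {}ek : e^phi * d^phi = u^phi ^+ k.
  apply/eqP; rewrite -rmorphM -rmorphXn -subr_eq0 -rmorphB; apply/eqP/inj.
  by rewrite rmorphB rmorphXn ek subrr.
have cop : coprimep d^phi u^phi.
  apply/Bezout_eq1_coprimepP; exists (1, - 'X).
  by rewrite /= dE mul1r mulNr addrAC subrr add0r.
have : coprimep d^phi (u^phi ^+ k) by rewrite coprimep_expr.
by rewrite -ek coprimepMr coprimepp => /andP[_ /eqP s1]; rewrite s1 in sd.
Qed.

Lemma field_after_inverting_base : field_after_inverting phi.
Proof.
have [u u0 hu] := Phi_field.
have [q0 q0n q0r] := algebraic_generator.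
have [q [qn qr] qmin] := @minimizer _ (fun q => q^phi != 0 /\ Phi q = 0)
  (fun q => size q^phi) q0 (conj q0n q0r).
have small p : Phi p = 0 -> (size p^phi < size q^phi)%N -> p^phi = 0.
  move=> pr; rewrite ltnNge => ps; apply: contrapT => /eqP pn.
  by case/negP: ps; apply: qmin.
have nz p : Phi p != 0 -> p^phi != 0.
  by apply: contraNneq => e; rewrite PhiE e horner0.
have topn p : p^phi != 0 -> phi (top p) != 0.
  by rewrite /top phi_top lead_coef_eq0.
have PhiZ c p : Phi (c *: p) = phi c * Phi p by rewrite -mul_polyC rmorphM.
(* A multiple of [u] of least degree: it is constant because the minimal [q] is irreducible. *)
have [g [gn [w gw]] gmin] := @minimizer _
  (fun g => Phi g != 0 /\ exists w, Phi g = Phi w * Phi u)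
  (fun g => size g^phi) u (conj u0 (ex_intro _ 1 (esym (etrans (congr1 (fun z => z * Phi u) (rmorph1 Phi)) (mul1r _))))).
(* Modulo [q], a scalar multiple of [g] reduces to a remainder that is again a nonzero multiple of
   [u]. *)
have gq : (size g^phi < size q^phi)%N.
  have [j [t [r [e sr]]]] := pseudo_division g qn.
  apply: leq_ltn_trans sr; apply: gmin.
  have er : Phi r = phi (top q) ^+ j * Phi g.
    have := PhiE (top q ^+ j *: g); rewrite e -PhiE rmorphD rmorphM qr mulr0 add0r.
    by rewrite PhiZ rmorphXn.
  split; first by rewrite er mulf_neq0 // expf_neq0 // topn.
  by exists ((top q ^+ j) *: w); rewrite er gw PhiZ rmorphXn mulrA.
(* Divide [q] by a nonconstant [g]: the remainder is a multiple of [u], so by minimality of [g] it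
   vanishes under [Phi], and then over [F]. The quotient also vanishes under [Phi] and is shorter
   than [q], so it is zero too, forcing [q] to vanish over [F]. *)
have g1 : (size g^phi <= 1)%N.
  rewrite leqNgt; apply/negP => g2.
  have [j [t [r [e sr]]]] := pseudo_division q (nz _ gn).
  have er : Phi t * Phi g + Phi r = 0.
    have := PhiE (top g ^+ j *: q); rewrite e -PhiE rmorphD rmorphM PhiZ qr.
    by rewrite mulr0 => <-.
  have r0 : Phi r = 0.
    apply: contrapT => /eqP rn; move: sr; rewrite ltnNge => /negP; apply.
    apply: gmin; split=> //; exists (- t * w).
    by rewrite rmorphM rmorphN !mulNr -mulrA -gw; apply/eqP; rewrite -addr_eq0 addrC er.
  have rz : r^phi = 0 by apply: small => //; exact: ltn_trans gq.
  have t0 : Phi t = 0.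
    by move: er; rewrite r0 addr0 => /eqP; rewrite mulf_eq0 (negPf gn) orbF => /eqP.
  have tz : t^phi = 0.
    have [//|tn] := eqVneq t^phi 0; apply: small => //.
    have sq : size q^phi = (size t^phi + size g^phi).-1.
      rewrite -size_mul ?(nz _ gn) //.
      have := congr1 (fun p : {poly F} => size p) e.
      rewrite map_polyZ size_scale; last by rewrite rmorphXn expf_neq0 // topn // nz.
      by rewrite rmorphD /= rz addr0 rmorphM.
    by rewrite sq -subn1 -addnBA ?(ltnW g2) // -[X in (X < _)%N]addn0 ltn_add2l subn_gt0.
  move: e; rewrite rmorphD rmorphM /= tz mul0r rz addr0 map_polyZ => /eqP.
  by rewrite scaler_eq0 rmorphXn expf_eq0 (negPf (topn _ (nz _ gn))) andbF (negPf qn).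
pose v := g`_0.
have gv : Phi g = phi v by rewrite PhiE (size1_polyC g1) hornerC coef_map.
have v0 : phi v != 0 by rewrite -gv.
have q2 : (1 < size q^phi)%N.
  rewrite ltnNge; apply/negP => q1; move: qr.
  rewrite PhiE (size1_polyC q1) hornerC => q0'.
  by move: qn; rewrite (size1_polyC q1) q0' polyC0 eqxx.
(* Powers of [top q] come from division by [q], powers of [v] from replacing [u] by its constant
   multiple. *)
exists (top q * v); first by rewrite rmorphM mulf_neq0 // topn.
move=> d d0; have [e [k ek]] := hu d%:P d0.
have [j [t [r [er sr]]]] := pseudo_division (e * w ^+ k) qn.
have key : Phi r * phi d = phi (top q ^+ j * v ^+ k).
  have := PhiE (top q ^+ j *: (e * w ^+ k)).
  rewrite er -PhiE PhiZ rmorphD (rmorphM _ t q) qr mulr0 add0r => <-.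
  rewrite !rmorphM !rmorphXn -gv gw exprMn -mulrA; congr (_ * _).
  by rewrite mulrC mulrA [phi d * _]mulrC -PhiC -rmorphM ek mulrC.
(* [s] has the root [Phi 'X] and is shorter than [q], so it is zero over [F]; its constant
   coefficient inverts [d] inside [A]. *)
pose s := d *: r - (top q ^+ j * v ^+ k)%:P.
have sz : s^phi = 0.
  apply: small.
    by rewrite rmorphB PhiZ PhiC -key mulrC subrr.
  rewrite rmorphB /= map_polyZ map_polyC /=.
  apply: leq_ltn_trans (size_polyD _ _) _.
  rewrite gtn_max size_polyN (leq_ltn_trans (size_polyC_leq1 _)) // andbT.
  exact: leq_ltn_trans (size_scale_leq _ _) sr.
have key2 : phi (d * r`_0) = phi (top q ^+ j * v ^+ k).
  apply/eqP; rewrite -subr_eq0 -rmorphB -(coef0 F 0) -sz coef_map.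
  by rewrite coefB coefZ coefC.
(* The extra factor equalizes the exponents of [top q] and [v]. *)
exists (r`_0 * (top q ^+ k * v ^+ j)), (j + k)%N.
rewrite mulrAC [r`_0 * d]mulrC rmorphM key2 -rmorphM -rmorphXn.
by congr (phi _); rewrite mulrACA -!exprD addnC exprMn.
Qed.

(** Pseudo-division by an algebraic equation [q] writes each value as [c^-1 * Phi r], with [c] in a
    finite set and [r] of bounded degree with coefficients from it. *)
Lemma finite_range_adjoin : finite_set (range phi) -> finite_set (range Phi).
Proof.
move=> fin.
have [q qn qr] := algebraic_generator.
have := finite_image2 (fun (c y : F) => c^-1 * y) fin
  (finite_horner (Phi 'X) (size q^phi) fin).
apply: sub_finite_set => _ [p _ <-].
have [j [t [r [e sr]]]] := pseudo_division p qn.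
have c0 : phi (top q ^+ j) != 0.
  by rewrite rmorphXn expf_neq0 // /top phi_top lead_coef_eq0.
exists (phi (top q ^+ j)); first by exists (top q ^+ j).
exists (Phi r).
  exists r^phi; split; [exact: ltnW | | exact: PhiE].
  by move=> i; rewrite coef_map; exists r`_i.
apply: (mulfI c0); rewrite mulrA mulfV // mul1r.
have := PhiE (top q ^+ j *: p).
by rewrite e -PhiE rmorphD (rmorphM _ t q) qr mulr0 add0r -mul_polyC rmorphM.
Qed.
End Adjoin.

Lemma poly_finite_in_fields (A : comNzRingType) :
  finite_in_fields A -> finite_in_fields {poly A}.
Proof.
move=> finA F Phi hPhi; apply: finite_range_adjoin => //.
by apply: finA; exact: field_after_inverting_base.
Qed.

(** * Hilbert's basis theorem *)

Definition acc (A : pzRingType) := forall I : nat -> set A,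
  (forall n, two_sided_ideal (I n)) -> (forall n x, I n x -> I n.+1 x) ->
  exists n, forall m x, I m x -> I n x.

Lemma chain_leq (T : Type) (I : nat -> set T) :
  (forall n x, I n x -> I n.+1 x) ->
  forall n m x, (n <= m)%N -> I n x -> I m x.
Proof.
move=> IS n m x /subnKC <-; elim: (m - n)%N => [|k IH]; first by rewrite addn0.
by move=> /IH /IS; rewrite addnS.
Qed.

(** A nonzero element of least absolute value in the union of the chain divides all others, by
    division with remainder. *)
Lemma acc_int : acc int.
Proof.
move=> I idI IS.
have [[k0 [x0 [Ix0 x00]]]|h] := pselect (exists k x, I k x /\ x != 0); last first.
  exists 0%N => m x Ix; have [I0 _ _ _] := idI 0%N.
  by have [->//|xn] := eqVneq x 0; case: h; exists m, x.
have [[k x] /= [Ix xn] xmin] := @minimizer (nat * int)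
  (fun kx => I kx.1 kx.2 /\ kx.2 != 0) (fun kx => absz kx.2) (k0, x0) (conj Ix0 x00).
exists k => m y Iy.
pose l := maxn k m.
have Ixl : I l x by apply: (chain_leq IS) Ix; exact: leq_maxl.
have Iyl : I l y by apply: (chain_leq IS) Iy; exact: leq_maxr.
have [_ _ Il _] := idI k; have [_ IB Ill _] := idI l.
suff r0 : (y %% x)%Z = 0 by rewrite (divz_eq y x) r0 addr0; exact: Il.
apply: contrapT => /eqP rn.
have Ir : I l (y %% x)%Z by apply: IB => //; exact: Ill.
have := xmin (l, (y %% x)%Z) (conj Ir rn); rewrite leqNgt /=.
by rewrite -ltz_nat gez0_abs ?modz_ge0 // ltz_mod.
Qed.

Section HilbertBasis.
Variables (A : comNzRingType) (I : nat -> set {poly A}).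
Hypothesis accA : acc A.
Hypothesis idI : forall n, two_sided_ideal (I n).
Hypothesis IS : forall n x, I n x -> I n.+1 x.

Let L (k d : nat) : set A :=
  [set a | exists2 p, I k p & (size p <= d.+1)%N /\ p`_d = a].

Lemma coef_ideal k d : two_sided_ideal (L k d).
Proof.
have [I0 IB Il _] := idI k.
have Ll r a : L k d a -> L k d (r * a).
  move=> [p Ip [sp <-]]; exists (r%:P * p); first exact: Il.
  by rewrite coefCM mul_polyC (leq_trans (size_scale_leq _ _)).
split=> // [|a b [p Ip [sp <-]] [q Iq [sq <-]]|r a]; last by rewrite mulrC; exact: Ll.
- by exists 0 => //; rewrite size_poly0 coef0.
- exists (p - q); first exact: IB.
  rewrite coefB; split=> //; apply: leq_trans (size_polyD _ _) _.
  by rewrite geq_max size_polyN sp.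
Qed.

Lemma coef_ideal_chain k d a : L k d a -> L k.+1 d a.
Proof. by move=> [p Ip h]; exists p => //; exact: IS. Qed.

Lemma coef_ideal_degree k d a : L k d a -> L k d.+1 a.
Proof.
have [_ _ _ Ir] := idI k.
move=> [p Ip [sp <-]]; exists (p * 'X); first exact: Ir.
split; last by rewrite coefMX.
by have [->|p0] := eqVneq p 0; rewrite ?mul0r ?size_poly0 // size_mulX.
Qed.

(** [L] grows in both indices. The diagonal chain stabilizes at some [n0], which settles all
    [d >= n0]; the finitely many smaller [d] are treated one at a time. *)
Lemma coef_ideal_stable : exists N, forall m d a, L m d a -> L N d a.
Proof.
have mono k m d e a : (k <= m)%N -> (d <= e)%N -> L k d a -> L m e a.
  move=> km de /(chain_leq (I := L ^~ d) (coef_ideal_chain^~ d) km).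
  exact: (chain_leq (I := L m) (coef_ideal_degree (k := m))) de.
have [n0 diag] : exists n, forall m a, L m m a -> L n n a.
  apply: accA => [n|n a]; first exact: coef_ideal.
  by apply: mono.
have [N0 low] : exists N, forall d, (d < n0)%N -> forall m a, L m d a -> L N d a.
  elim: {diag} n0 => [|n0 [N IH]]; first by exists 0%N.
  have [N' hN'] : exists n, forall m a, L m n0 a -> L n n0 a.
    apply: accA => [n|n a]; [exact: coef_ideal | exact: coef_ideal_chain].
  exists (maxn N N') => d; rewrite ltnS leq_eqVlt => /predU1P[-> m a /hN'|/IH h m a /h].
    by apply: mono => //; exact: leq_maxr.
  by apply: mono => //; exact: leq_maxl.
exists (maxn n0 N0) => m d a.
have [dn|nd] := ltnP d n0.
  by move/(low _ dn); apply: mono => //; exact: leq_maxr.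
move=> /(mono _ _ _ _ _ (leq_maxl m d) (leq_maxr m d))/diag.
by apply: mono => //; exact: leq_maxl.
Qed.

(** Subtracting an element of [I N] with the same leading coefficient shortens [p]. The difference
    may lie only in a later ideal, so the induction is over all [m]. *)
Lemma poly_chain_stable : exists n, forall m p, I m p -> I n p.
Proof.
have [N hN] := coef_ideal_stable; exists N => m p.
have [n] := ubnP (size p); elim: n m p => // n IH m p sp Ip.
have [->|p0] := eqVneq p 0; first by have [] := idI N.
have sp0 : (0 < size p)%N by rewrite size_poly_gt0.
have [q Iq [sq cq]] : L N (size p).-1 p`_(size p).-1.
  by apply: (hN m); exists p; rewrite ?prednK.
pose M := maxn m N.
have Ipq : I M (p - q).
  have [_ IB _ _] := idI M.
  by apply: IB; [apply: (chain_leq IS) Ip; exact: leq_maxl |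
                 apply: (chain_leq IS) Iq; exact: leq_maxr].
have [_ IB _ _] := idI N.
have {}IB u v : I N u -> I N v -> I N (u + v).
  move=> Iu Iv; rewrite -[v]opprK; apply: (IB) => //.
  by rewrite -sub0r; apply: IB => //; have [] := idI N.
rewrite -(subrK q p); apply: IB => //; apply: (IH M) => //.
rewrite -ltnS; apply: leq_trans sp; rewrite ltnS -(prednK sp0) ltnS.
apply/leq_sizeP => j; rewrite leq_eqVlt => /predU1P[<-|jp].
  by rewrite coefB cq subrr.
by rewrite coefB !nth_default ?subrr //; [apply: leq_trans sq _|]; rewrite ?prednK // -(prednK sp0).
Qed.
End HilbertBasis.

Lemma acc_poly (A : comNzRingType) : acc A -> acc {poly A}.
Proof. by move=> accA I idI IS; exact: poly_chain_stable. Qed.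

Lemma acc_surj (A B : pzRingType) (g : {rmorphism A -> B}) :
  (forall b, exists a, g a = b) -> acc A -> acc B.
Proof.
move=> sg accA I idI IS.
have [n|n x|n hn] := accA (fun n => g @^-1` (I n)).
- have [I0 IB Il Ir] := idI n; split=> /= [|x y|r x|r x].
  + by rewrite rmorph0.
  + by rewrite rmorphB; exact: IB.
  + by rewrite rmorphM; exact: Il.
  + by rewrite rmorphM; exact: Ir.
- exact: IS.
by exists n => m b; have [a <-] := sg b; exact: hn.
Qed.

(** Ideals containing the kernel are determined by their images, so only the quotient has to be
    noetherian. *)
Lemma chain_above_kernel (R Q : pzRingType) (f : {rmorphism R -> Q}) (I : nat -> set R) :
  (forall q, exists x, f x = q) -> acc Q ->
  (forall n, two_sided_ideal (I n)) -> (forall n x, I n x -> I n.+1 x) ->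
  (forall n x, f x = 0 -> I n x) ->
  exists n, forall m x, I m x -> I n x.
Proof.
move=> sf accQ idI IS Ik.
have [n|n _ [x Ix <-]|n hn] := accQ (fun n => f @` (I n)).
- have [I0 IB Il Ir] := idI n; split.
  + by exists 0; rewrite ?rmorph0.
  + by move=> _ _ [x Ix <-] [y Iy <-]; exists (x - y); [exact: IB | rewrite rmorphB].
  + move=> r _ [x Ix <-]; have [s <-] := sf r.
    by exists (s * x); [exact: Il | rewrite rmorphM].
  + move=> r _ [x Ix <-]; have [s <-] := sf r.
    by exists (x * s); [exact: Ir | rewrite rmorphM].
- by exists x => //; exact: IS.
exists n => m x Ix; have [|y Iy e] := hn m (f x); first by exists x.
have [I0 IB _ _] := idI n.
rewrite -[x](subKr y); apply: IB => //; apply: Ik.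
by rewrite rmorphB e subrr.
Qed.

(** * Square-zero heart *)

(** Commuting maps that agree at [c] agree everywhere, since every element is some [k c] with [k] in
    [E]. So elements correspond to maps through their value at [c], and applying the map of [x] to
    [y] is the field product, with unit [c]. *)
Lemma field_of_commuting_maps (V : zmodType) (E : set (V -> V)) (c : V) :
  c <> 0 ->
  (forall h x y, E h -> h (x + y) = h x + h y) ->
  (forall h k x, E h -> E k -> h (k x) = k (h x)) ->
  (forall x y, x <> 0 -> exists2 h, E h & h x = y) ->
  exists (F : fieldType) (iota : {additive F -> V}),
    [/\ injective iota, forall v, exists x, iota x = v, iota 1 = c &
      forall h, E h -> exists g, forall x, iota (g * x) = h (iota x)].
Proof.
(* The [Build] factories do not infer the structure of a variable [V]. *)
case: V E c => T clT; set V := GRing.Zmodule.Pack clT => E c c0 ED EC Etrans.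
have /choice[m mP] : forall y, exists h : V -> V, E h /\ h c = y.
  by move=> y; have [h Eh hc] := Etrans c y c0; exists h.
have Em y : E (m y) by case: (mP y).
have mc y : m y c = y by case: (mP y).
have unique h k z : E h -> E k -> h c = k c -> h z = k z.
  by move=> Eh Ek e; rewrite -(mc z) EC // e EC.
have mulC : commutative m by move=> x y; rewrite -{1}(mc y) EC // mc.
have mulA : associative m by move=> x y z; rewrite (mulC y z) EC // mulC.
have mul1 : left_id c m by move=> x; rewrite mulC mc.
have mulD : left_distributive m +%R.
  by move=> x y z; rewrite !(mulC _ z) ED.
have c0b : c != 0 by apply/eqP.
pose R1 := GRing.Zmodule_isComNzRing.Build V mulA mulC mul1 mulD c0b.
pose K : comNzRingType := HB.pack V R1.
have /choice[inv invP] : forall y, exists z, (y <> 0 -> m z y = c) /\ (y = 0 -> z = 0).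
  move=> y; have [->|y0] := pselect (y = 0); first by exists 0.
  have [k Ek ky] := Etrans y c y0.
  exists (k c); split=> // _.
  by rewrite mulC EC // mc.
have mulV (x : K) : x != 0 -> (inv x : K) * x = 1.
  by move=> /eqP x0; apply: (invP x).1.
have inv0 : inv (0 : K) = (0 : K) by apply: (invP 0).2.
pose R2 := GRing.ComNzRing_isField.Build K mulV inv0.
pose F : fieldType := HB.pack K R2.
have idB : zmod_morphism (id : F -> V) by [].
pose I1 := GRing.isZmodMorphism.Build F V id idB.
pose iota : {additive F -> V} := HB.pack (id : F -> V) I1.
exists F, iota; split=> // [v|h Eh]; first by exists v.
exists (h c) => x; change (m (h c) x = h x).
by apply: unique; rewrite ?mc.
Qed.

Lemma extend_to_poly (A B : comNzRingType) (phi : {rmorphism A -> B}) (x : B) :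
  exists Phi : {rmorphism {poly A} -> B},
    (forall a, Phi a%:P = phi a) /\ Phi 'X = x.
Proof.
exists (horner_eval x \o map_poly phi : {rmorphism {poly A} -> B}).
by split=> [a|]; rewrite /= /horner_eval ?map_polyC ?map_polyX ?hornerC ?hornerX.
Qed.

(** The operators sending [x] to a sum of terms [r x s]; additive subgroups stable under them are
    the two-sided ideals. *)
Inductive multiplication (R : pzRingType) : (R -> R) -> Prop :=
| MulL r : multiplication ( *%R r)
| MulR r : multiplication ( *%R^~ r)
| MulD h k : multiplication h -> multiplication k ->
    multiplication (fun x => h x + k x)
| MulComp h k : multiplication h -> multiplication k ->
    multiplication (fun x => h (k x)).

Lemma finite_repetition (T : Type) (D : set T) (g : nat -> T) :
  finite_set D -> (forall n, D (g n)) -> exists i j, (i < j)%N /\ g i = g j.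
Proof.
move=> finD Dg; apply: contrapT => h; apply: infinite_nat.
have -> : [set: nat] = g @^-1` D by apply/seteqP; split=> n _ //=.
apply: finite_preimage finD => i j _ _ e.
by have [ij|ij|//] := ltngtP i j; case: h; [exists i, j | exists j, i].
Qed.

Lemma finite_range_monic (A B : comNzRingType) (Phi : {rmorphism {poly A} -> B}) (q : {poly A}) :
  finite_set (range (Phi \o polyC)) -> q \is monic -> Phi q = 0 ->
  finite_set (range Phi).
Proof.
move=> fin qm q0; have := finite_horner (Phi 'X) (size q) fin.
apply: sub_finite_set => _ [p _ <-]; pose r := Pdiv.Ring.rmodp p q.
exists (map_poly (Phi \o polyC) r); split.
- apply: leq_trans (size_poly _ _) _; apply: ltnW.
  by rewrite Pdiv.Ring.ltn_rmodp monic_neq0.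
- by move=> i; rewrite coef_map; exists r`_i.
by rewrite -rmorph_horner {1}(Pdiv.RingMonic.rdivp_eq qm p) rmorphD rmorphM q0 mulr0 add0r.
Qed.

Lemma monic_expB (A : nzRingType) (i j : nat) : (i < j)%N ->
  ('X^j - 'X^i : {poly A}) \is monic.
Proof.
move=> ij; rewrite monicE lead_coefDl ?lead_coefXn //.
by rewrite size_polyN !size_polyXn.
Qed.

Section SquareZeroHeart.
Variable R : pzRingType.
Hypothesis Rmin : minimal_noncommutative R.
Hypothesis heart_sq : forall x y : R, heart x -> heart y -> x * y = 0.

Lemma multiplicationD (h : R -> R) (x y : R) : multiplication h -> h (x + y) = h x + h y.
Proof.
move=> mh; elim: mh x y => [r|r|{}h k _ IHh _ IHk|{}h k _ IHh _ IHk] x y.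
- exact: mulrDr.
- exact: mulrDl.
- by rewrite IHh IHk addrACA.
- by rewrite IHk IHh.
Qed.

Lemma multiplication_heart (h : R -> R) x : multiplication h -> heart x -> heart (h x).
Proof.
move=> mh; elim: mh x => [r|r|{}h k _ IHh _ IHk|{}h k _ IHh _ IHk] x hx.
- exact: heartMl.
- exact: heartMr.
- by apply: heartD; [exact: IHh | exact: IHk].
- by apply: IHh; exact: IHk.
Qed.

(** The commutator of [r] and [s] lies in the heart, so it annihilates [x]. *)
Lemma heart_mulCl (x r s : R) : heart x -> r * (s * x) = s * (r * x).
Proof.
move=> hx; apply/eqP; rewrite -subr_eq0 !mulrA -mulrBl.
by apply/eqP/heart_sq => //; exact: heart_comm.
Qed.

Lemma heart_mulCr (x r s : R) : heart x -> x * s * r = x * r * s.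
Proof.
move=> hx; apply/eqP; rewrite -subr_eq0 -!mulrA -mulrBr.
by apply/eqP/heart_sq => //; exact: heart_comm.
Qed.

Lemma multiplication_comm (h k : R -> R) x :
  multiplication h -> multiplication k -> heart x -> h (k x) = k (h x).
Proof.
move=> mh mk; elim: mh x => [r|r|{}h h' _ IHh _ IHh'|{}h h' _ IHh mh' IHh'] x hx.
- elim: mk x hx => [s|s|{}k k' _ IHk _ IHk'|{}k k' _ IHk mk' IHk'] x hx.
  + exact: heart_mulCl.
  + exact: mulrA.
  + by rewrite mulrDr IHk // IHk'.
  + by rewrite IHk ?IHk' //; exact: multiplication_heart.
- elim: mk x hx => [s|s|{}k k' _ IHk _ IHk'|{}k k' _ IHk mk' IHk'] x hx.
  + by rewrite mulrA.
  + exact: heart_mulCr.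
  + by rewrite mulrDl IHk // IHk'.
  + by rewrite IHk ?IHk' //; exact: multiplication_heart.
- by rewrite IHh // IHh' // multiplicationD.
- by rewrite IHh' // IHh //; exact: multiplication_heart.
Qed.

(** The images of [x] under multiplications form a nonzero ideal. *)
Lemma multiplication_trans (x y : R) : heart x -> x <> 0 -> heart y ->
  exists2 h, multiplication h & h x = y.
Proof.
move=> hx x0; move: y.
apply: (heart_sub (I := [set y | exists2 h, multiplication h & h x = y]) (u := x)) => //; last first.
  by exists ( *%R 1); [exact: MulL | rewrite mul1r].
split=> [|_ _ [h mh <-] [k mk <-]|r _ [h mh <-]|r _ [h mh <-]].
- by exists ( *%R 0); [exact: MulL | rewrite mul0r].
- exists (fun z => h z + (- 1) * k z); last by rewrite mulN1r.
  by apply: MulD => //; apply: (MulComp (MulL _)).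
- by exists (fun z => r * h z) => //; apply: (MulComp (MulL _)).
- by exists (fun z => h z * r) => //; apply: (MulComp (MulR _)).
Qed.

(* The heart is a simple module over commuting multiplications, hence a field,
   generated as a ring by the four multiplications by [a] and [b]. *)
Lemma heart_finite : finite_set (@heart R).
Proof.
have [a [b ab]] := noncomm_pair Rmin.
pose c := a * b - b * a.
have c0 : c <> 0 by move=> /eqP; rewrite subr_eq0 => /eqP.
have hc : heart c by exact: heart_comm.
have [V [vl [hV toV vlD Vinj]]] : exists (V : zmodType) (vl : {additive V -> R}),
    [/\ forall v, heart (vl v), forall x, heart x -> exists v, vl v = x,
      forall u v, vl (u + v) = vl u + vl v & injective vl].
  pose P : {pred R} := fun x => `[< heart x >].
  have PC : zmod_closed P.
    split; first by apply/asboolP; exact: heart0.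
    by move=> x y /asboolP hx /asboolP hy; apply/asboolP; exact: heartB.
  pose P1 := GRing.isZmodClosed.Build R P PC.
  pose PZ : zmodClosed R := HB.pack P P1.
  pose T := {x : R | x \in PZ}.
  pose T1 := [SubChoice_isSubZmodule of T by <:].
  pose V : zmodType := HB.pack T T1.
  have valB : zmod_morphism (val : V -> R) by [].
  pose vl1 := GRing.isZmodMorphism.Build V R (val : V -> R) valB.
  pose vl : {additive V -> R} := HB.pack (val : V -> R) vl1.
  exists V, vl; split=> [v|x hx|u v|u v e].
  - by have /asboolP := valP v.
  - have Px : x \in PZ by apply/asboolP.
    by exists (Sub x Px).
  - exact: raddfD.
  - exact: val_inj.
have [cV cVE] := toV c hc.
have cV0 : cV <> 0 by move=> e; apply: c0; rewrite -cVE e raddf0.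
pose E : set (V -> V) := [set h' | exists2 h, multiplication h &
  forall v, vl (h' v) = h (vl v)].
have EP h : multiplication h -> exists2 h', E h' & forall v, vl (h' v) = h (vl v).
  move=> mh; have /choice[h' h'E] : forall v : V, exists w : V, vl w = h (vl v).
    by move=> v; apply: toV; exact: multiplication_heart.
  by exists h' => //; exists h.
have [|h k x [h' mh hE] [k' mk kE]|x y x0|F [iota [iotaI iotaS iota1 iotaE]]] :=
  @field_of_commuting_maps V E cV cV0.
- move=> h x y [h' mh hE]; apply: Vinj.
  by rewrite vlD !hE vlD multiplicationD.
- by apply: Vinj; rewrite hE kE kE hE; apply: (multiplication_comm mh mk).
- have x0' : vl x <> 0 by move=> e; apply: x0; apply: Vinj; rewrite e raddf0.
  have [h mh hx] := multiplication_trans (hV x) x0' (hV y).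
  by have [h' Eh' h'E] := EP h mh; exists h' => //; apply: Vinj; rewrite h'E.
have gen h : multiplication h -> exists g, forall x, vl (iota (g * x)) = h (vl (iota x)).
  move=> mh; have [h' Eh' h'E] := EP h mh.
  by have [g gE] := iotaE h' Eh'; exists g => x; rewrite gE.
have [g1 g1E] := gen _ (MulL a); have [g2 g2E] := gen _ (MulL b).
have [g3 g3E] := gen _ (MulR a); have [g4 g4E] := gen _ (MulR b).
(* [Phi] evaluates integer polynomials in four variables at the field elements acting as the
   multiplications by [a] and [b]. *)
have [Phi1 [Phi1C Phi1X]] := extend_to_poly (intmul 1 : {rmorphism int -> F}) g1.
have [Phi2 [Phi2C Phi2X]] := extend_to_poly Phi1 g2.
have [Phi3 [Phi3C Phi3X]] := extend_to_poly Phi2 g3.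
have [Phi [PhiC PhiX]] := extend_to_poly Phi3 g4.
have ran1 : exists p, Phi p = g1.
  by exists ('X%:P%:P%:P); rewrite PhiC Phi3C Phi2C.
have ran2 : exists p, Phi p = g2 by exists ('X%:P%:P); rewrite PhiC Phi3C.
have ran3 : exists p, Phi p = g3 by exists ('X%:P); rewrite PhiC.
have ran4 : exists p, Phi p = g4 by exists 'X.
(* The image of [Phi] inside [R]. Being stable under [a] and [b] on both sides, it is an ideal; it
   contains [c], hence the heart, so [Phi] is onto. *)
pose Im := [set x : R | exists p, x = vl (iota (Phi p))].
have ImB x y : Im x -> Im y -> Im (x - y).
  by move=> [p ->] [q ->]; exists (p - q); rewrite rmorphB !raddfB.
have Img g h x : (forall x, vl (iota (g * x)) = h (vl (iota x))) ->
    (exists p, Phi p = g) -> Im x -> Im (h x).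
  by move=> gE [p pg] [q ->]; exists (p * q); rewrite rmorphM pg gE.
have ImL r x : Im x -> Im (r * x).
  move: r x; apply: (noncomm_pair_generates Rmin ab).
  - by move=> x; rewrite mul1r.
  - by move=> u v hu hv x Ix; rewrite mulrBl; apply: ImB; [exact: hu | exact: hv].
  - by move=> u v hu hv x Ix; rewrite -mulrA; apply: hu; exact: hv.
  - by move=> x; exact: (Img g1).
  - by move=> x; exact: (Img g2).
have ImR r x : Im x -> Im (x * r).
  move: r x; apply: (noncomm_pair_generates Rmin ab).
  - by move=> x; rewrite mulr1.
  - by move=> u v hu hv x Ix; rewrite mulrBr; apply: ImB; [exact: hu | exact: hv].
  - by move=> u v hu hv x Ix; rewrite mulrA; apply: hv; exact: hu.
  - by move=> x; exact: (Img g3 ( *%R^~ a)).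
  - by move=> x; exact: (Img g4 ( *%R^~ b)).
have Imc : Im c by exists 1; rewrite rmorph1 iota1.
have Im0 : Im 0 by rewrite -(subrr c); exact: ImB.
have Imh : forall x, heart x -> Im x.
  by apply: (heart_sub (I := Im) (u := c)) => //.
have Phi_surj x : exists p, Phi p = x.
  have [p e] := Imh _ (hV (iota x)).
  by exists p; apply: iotaI; apply: Vinj.
have finPhi : finite_set (range Phi).
  apply: (poly_finite_in_fields (poly_finite_in_fields (poly_finite_in_fields
    (poly_finite_in_fields int_finite_in_fields)))).
  (* [Phi] is onto a field, so nothing has to be inverted. *)
  exists 1; first by rewrite rmorph1 oner_neq0.
  move=> d d0; have [e ed] := Phi_surj (Phi d)^-1.
  by exists e, 0%N; rewrite rmorphM ed mulVf.
have := finite_image (fun x => vl (iota x)) finPhi.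
apply: sub_finite_set => x /Imh[p ->].
by exists (Phi p) => //; exists p.
Qed.

Lemma quotient_by_heart : exists (K : comNzRingType) (f : {rmorphism R -> K}),
  (forall y, exists x, f x = y) /\ (forall x, f x = 0 <-> heart x).
Proof.
have [Q [f [sf kf]]] := quotient_exists (heart_ideal R).
have mulC : commutative (@GRing.mul Q).
  move=> y z; have [x <-] := sf y; have [x' <-] := sf z.
  apply/eqP; rewrite -subr_eq0 -!rmorphM -rmorphB; apply/eqP/kf.
  exact: heart_comm.
have nz : (1 : Q) != 0.
  apply/eqP; rewrite -(rmorph1 f) => /kf h1; apply: (one_neq0 Rmin).
  by rewrite -(mulr1 1) heart_sq.
case: Q f sf kf mulC nz => T clT; set Q := GRing.PzRing.Pack clT => f sf kf mulC nz.
pose K1 := GRing.PzSemiRing_isNonZero.Build Q nz.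
pose K2 := GRing.PzRing_hasCommutativeMul.Build Q mulC.
pose K : comNzRingType := HB.pack Q K1 K2.
by exists K, (f : {rmorphism R -> K}).
Qed.

Lemma poly_onto_quotient (K : comNzRingType) (f : {rmorphism R -> K}) (a b : R) :
  a * b <> b * a -> (forall y, exists x, f x = y) ->
  exists (Phi1 : {rmorphism {poly int} -> K}) (Phi : {rmorphism {poly {poly int}} -> K}),
    [/\ Phi1 'X = f a, forall p, Phi p%:P = Phi1 p, Phi 'X = f b &
      forall y, exists p, Phi p = y].
Proof.
move=> ab sf.
have [Phi1 [_ Phi1X]] := extend_to_poly (intmul 1 : {rmorphism int -> K}) (f a).
have [Phi [PhiC PhiX]] := extend_to_poly Phi1 (f b).
exists Phi1, Phi; split=> // y; have [x <-] := sf y; move: x {y}.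
apply: (noncomm_pair_generates Rmin ab).
- by exists 1; rewrite !rmorph1.
- by move=> u v [p pu] [q qv]; exists (p - q); rewrite !rmorphB pu qv.
- by move=> u v [p pu] [q qv]; exists (p * q); rewrite !rmorphM pu qv.
- by exists 'X%:P; rewrite PhiC.
- by exists 'X.
Qed.

Lemma central_nilpotent (z : R) : (forall r, z * r = r * z) ->
  (forall h, heart h -> z * h = 0) -> exists k, z ^+ k = 0.
Proof.
move=> zC zh; have [K [f [sf kf]]] := quotient_by_heart.
have [a [b ab]] := noncomm_pair Rmin.
have [_ [Phi [_ _ _ sPhi]]] := poly_onto_quotient ab sf.
have accK : acc K := acc_surj sPhi (acc_poly (acc_poly acc_int)).
have zkC k r : z ^+ k * r = r * z ^+ k.
  by apply/esym; apply: commrX; exact/esym/zC.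
(* The exponent starts at 1, so that already [I 0] contains the heart, the kernel of [f]. *)
pose I n : set R := [set r | z ^+ n.+1 * r = 0].
have [n|n r|n r /kf hr|n hn] := chain_above_kernel (f := f) (I := I) sf accK.
- rewrite /I; split=> [|x y|r x|r x] /=.
  + by rewrite mulr0.
  + by rewrite mulrBr => -> ->; rewrite subrr.
  + by move=> e; rewrite mulrA (zkC _ r) -mulrA e mulr0.
  + by move=> e; rewrite mulrA e mul0r.
- by rewrite /I /= => e; rewrite exprS -mulrA e mulr0.
- by rewrite /I /= exprSr -mulrA zh // mulr0.
exists n.+1; apply: contrapT => zn.
have c0 : a * b - b * a <> 0 by move=> /eqP; rewrite subr_eq0 => /eqP.
have [r cr] : exists r, a * b - b * a = z ^+ n.+1 * r.
  apply: (heart_sub (I := [set x | exists r, x = z ^+ n.+1 * r]) (u := z ^+ n.+1)) => //.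
  - split=> [|_ _ [x ->] [y ->]|r _ [x ->]|r _ [x ->]] /=.
    + by exists 0; rewrite mulr0.
    + by exists (x - y); rewrite mulrBr.
    + by exists (r * x); rewrite mulrA -zkC mulrA.
    + by exists (x * r); rewrite mulrA.
  - by exists 1; rewrite mulr1.
  - exact: heart_comm.
(* As [z] kills the commutator [z^(n+1) r], the element [r] lies in [I n.+1], hence in [I n], and
   the commutator is zero. *)
apply: c0; rewrite cr; apply: (hn n.+1).
by rewrite /I /= exprS -mulrA -cr zh //; exact: heart_comm.
Qed.

(* [m ^+ 2] is central, as [[m, r]] lies in the heart. *)
Lemma annihilator_nilpotent (m : R) : (forall h, heart h -> m * h = 0) ->
  (forall h, heart h -> h * m = 0) -> exists k, m ^+ k = 0.
Proof.
move=> mh hm; have [|h hh|k mk] := @central_nilpotent (m ^+ 2); last 1 first.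
- by exists (2 * k)%N; rewrite exprM.
- move=> r.
  have e1 := mh _ (heart_comm Rmin m r); have e2 := hm _ (heart_comm Rmin m r).
  move: e1 e2; rewrite mulrBr mulrBl => /eqP; rewrite subr_eq0 => /eqP e1 /eqP.
  by rewrite subr_eq0 => /eqP e2; rewrite expr2 -mulrA e1 mulrA e2 mulrA.
- by rewrite expr2 -mulrA (mh _ hh) mulr0.
Qed.

(** The heart elements killed by [m] form an ideal, because left multiplications commute on the
    heart. *)
Lemma annihilates_heartl (m c : R) : heart c -> c <> 0 -> m * c = 0 ->
  forall h, heart h -> m * h = 0.
Proof.
move=> hc c0 mc h hh.
suff [] : [set x | heart x /\ m * x = 0] h by [].
apply: (heart_sub _ _ c0) hh => //.
split=> [|x y [hx ex] [hy ey]|r x [hx ex]|r x [hx ex]]; split.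
- exact: heart0.
- by rewrite mulr0.
- exact: heartB.
- by rewrite mulrBr ex ey subrr.
- exact: heartMl.
- by rewrite heart_mulCl // ex mulr0.
- exact: heartMr.
- by rewrite mulrA ex mul0r.
Qed.

Lemma annihilates_heartr (m c : R) : heart c -> c <> 0 -> c * m = 0 ->
  forall h, heart h -> h * m = 0.
Proof.
move=> hc c0 mc h hh.
suff [] : [set x | heart x /\ x * m = 0] h by [].
apply: (heart_sub _ _ c0) hh => //.
split=> [|x y [hx ex] [hy ey]|r x [hx ex]|r x [hx ex]]; split.
- exact: heart0.
- by rewrite mul0r.
- exact: heartB.
- by rewrite mulrBl ex ey subrr.
- exact: heartMl.
- by rewrite -mulrA ex mulr0.
- exact: heartMr.
- by rewrite heart_mulCr // ex mul0r.
Qed.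

(** In the finite heart the elements [x^n c] repeat, and so do the [c x^n]. One difference of powers
    thus kills the heart from the left, another from the right, and their product from both
    sides. *)
Lemma monic_equation (x : R) : exists i j i' j' k, [/\ (i < j)%N, (i' < j')%N &
  ((x ^+ j - x ^+ i) * (x ^+ j' - x ^+ i')) ^+ k = 0].
Proof.
have [a [b ab]] := noncomm_pair Rmin.
have c0 : a * b - b * a <> 0 by move=> /eqP; rewrite subr_eq0 => /eqP.
have hc := heart_comm Rmin a b.
set c := a * b - b * a in c0 hc.
have fin := heart_finite.
have [n|i [j [ij e]]] := finite_repetition (g := fun n => x ^+ n * c) fin.
  exact: heartMl.
have [n|i' [j' [ij' e']]] := finite_repetition (g := fun n => c * x ^+ n) fin.
  exact: heartMr.
have [h hh|h hh|k mk] := @annihilator_nilpotent ((x ^+ j - x ^+ i) * (x ^+ j' - x ^+ i')).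
- rewrite -mulrA; apply: (annihilates_heartl hc c0); last exact: heartMl.
  by rewrite mulrBl e subrr.
- rewrite mulrA; apply: (annihilates_heartr hc c0); last exact: heartMr.
  by rewrite mulrBr e' subrr.
by exists i, j, i', j', k.
Qed.

(** The multiples [n c] repeat in the finite heart, so a nonzero integer kills the heart; it is
    central, hence nilpotent in [R]. *)
Lemma integer_equation : exists2 n : int, n != 0 & n%:~R = 0 :> R.
Proof.
have [a [b ab]] := noncomm_pair Rmin.
have c0 : a * b - b * a <> 0 by move=> /eqP; rewrite subr_eq0 => /eqP.
have hc := heart_comm Rmin a b.
set c := a * b - b * a in c0 hc.
have [n|i [j [ij e]]] := finite_repetition (g := fun n => n%:R * c)
  heart_finite; first exact: heartMl.
pose z : int := j%:Z - i%:Z.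
have zR : z%:~R = j%:R - i%:R :> R by rewrite intrB.
have [r|h hh|k zk] := @central_nilpotent z%:~R.
- exact/esym/commr_int.
- by apply: (annihilates_heartl hc c0) hh; rewrite zR mulrBl e subrr.
exists (z ^+ k); last by rewrite rmorphXn.
by rewrite expf_neq0 // subr_eq0 eqz_nat gtn_eqF.
Qed.

(** The quotient by the heart arises from a finite image of the integers by adjoining the images of
    [a] and [b], each a root of a monic polynomial. Then [R] is a finite union of cosets of the
    finite heart. *)
Lemma finite_of_square_zero_heart : finite_set [set: R].
Proof.
have [K [f [sf kf]]] := quotient_by_heart.
have [a [b ab]] := noncomm_pair Rmin.
have [Phi1 [Phi [Phi1X PhiC PhiX sPhi]]] := poly_onto_quotient ab sf.
have adjoin (A : comNzRingType) (Psi : {rmorphism {poly A} -> K}) (x : R) :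
    Psi 'X = f x -> finite_set (range (Psi \o polyC)) -> finite_set (range Psi).
  move=> PsiX fin; have [i [j [i' [j' [k [ij ij' e]]]]]] := monic_equation x.
  apply: (finite_range_monic fin (q := (('X^j - 'X^i) * ('X^j' - 'X^i')) ^+ k)).
    by rewrite monic_exp // monicMl ?monic_expB.
  rewrite rmorphXn rmorphM !rmorphB !rmorphXn /= PsiX.
  by rewrite -!rmorphXn -!rmorphB -rmorphM -rmorphXn e rmorph0.
have finK : finite_set (range Phi).
  apply: (adjoin _ _ b) => //.
  have -> : range (Phi \o polyC) = range Phi1.
    by congr (image _ _); apply/funext => p /=; rewrite PhiC.
  apply: (adjoin _ _ a) => //.
  have [n n0 nz] := integer_equation.
  apply: (finite_range_int (phi := Phi1 \o polyC) n0).
  by rewrite -[n]intz rmorph_int -(rmorph_int f) nz rmorph0.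
have /choice[g gE] := sf.
have := finite_image2 (fun y h => g y + h) finK heart_finite.
apply: sub_finite_set => x _.
have [p pE] := sPhi (f x).
exists (f x); first by exists p.
exists (x - g (f x)); last by rewrite addrC subrK.
by apply/kf; rewrite rmorphB gE subrr.
Qed.
End SquareZeroHeart.

Theorem theorem5p9 (R : pzRingType) :
  infinite_set [set: R] -> minimal_noncommutative R -> division_ring R.
Proof.
move=> infR Rmin.
have [sq|nsq] := pselect (forall x y : R, heart x -> heart y -> x * y = 0).
  by case: infR; exact: finite_of_square_zero_heart.
exact: division_of_prime.
Qed.
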